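(* The set $\mathcal{D}(\mathbb{R})$ is a group under composition of maps.
   Context: $\mathcal{D}(\mathbb{R})$ is the set of maps $\eta:\mathbb{R}\to\mathbb{R}$ such that: (1) $\eta$ is $C^1$ with $a\le\eta'(x)\le b$ on $\mathbb{R}$ for some $0<a<b$ (depending on $\eta$); (2) $\int_{\mathbb{R}}|\eta(x)-x|^2dx<\infty$ and $\int_{\mathbb{R}}|\eta'(x)-1|^2dx<\infty$; (3) $\lim_{|x|\to\infty}\eta'(x)=1$. *)

(* Defs.v *)
From HB Require Import structures.
From mathcomp Require Import all_boot all_order all_algebra.
From mathcomp Require Import all_classical all_reals all_analysis.

Set Implicit Arguments.
Unset Strict Implicit.
Unset Printing Implicit Defensive.

Import Order.TTheory GRing.Theory Num.Theory.
Import numFieldNormedType.Exports.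

Local Open Scope ring_scope.
Local Open Scope classical_set_scope.

Section DiffR.
Variable R : realType.

(* In ring_scope this notation otherwise denotes the polynomial derivative. *)
Local Notation "f ^` ()" := (derive1 f) : ring_scope.
Local Notation mu := (@lebesgue_measure R).

(* The last field splits the limit as |x| goes to infinity into its two ends. *)
Record in_DR (eta : R -> R) : Prop := InDR {
  DR_derivable : forall x, derivable eta x 1;
  DR_continuous_derive : continuous eta^`();
  DR_derive_bounds : exists a b : R,
    [/\ 0 < a, a < b & forall x, a <= eta^`() x <= b];
  DR_L2 : (\int[mu]_x (`|eta x - x| ^+ 2)%:E < +oo)%E;
  DR_derive_L2 : (\int[mu]_x (`|eta^`() x - 1| ^+ 2)%:E < +oo)%E;
  DR_derive_lim : (eta^`() x @[x --> +oo] --> (1 : R)) /\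
                  (eta^`() x @[x --> -oo] --> (1 : R))
}.

Definition DR : set (R -> R) := [set eta | in_DR eta].

End DiffR.

(* The elements of A, seen as a type (the coercion of A to set_type A), carry
   a groupType structure whose product is the restriction of op to A; in
   particular A is closed under op. The choiceType part of groupType adds no
   requirement, since every type has such a structure classically. *)
Definition is_group_under (T : Type) (A : set T) (op : T -> T -> T) : Prop :=
  exists c : monoid.Group.axioms_ A,
    let G : groupType := monoid.Group.Pack c in
    forall x y : G, \val (x * y)%g = op (\val x) (\val y).

(* Main.v *)
From HB Require Import structures.
Require Import Defs.
From mathcomp Require Import all_boot all_order all_algebra.
From mathcomp Require Import all_classical all_reals all_analysis.
From mathcomp Require Import measurable_realfun.
From mathcomp Require Import ring lra.

(** The substance is stability of D(R) under composition and inversion; the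
    group laws then hold because they hold for composition of maps.

    An element f of D(R) has f' >= a > 0, so it is a C^1 bijection of the line
    that tends to +oo and -oo at the two ends, and composing with it costs only
    a constant in L^2: substituting y = f x,
      a * \int |h (f x)|^2 dx <= \int |h (f x)|^2 f' x dx = \int |h y|^2 dy
    ([expanding_square_integrable_comp]). Everything reduces to this estimate.

    For a composite, with b and d upper bounds of f' and g',
      f (g x) - x = (f y - y) + (g x - x),                      y = g x,
      (f o g)' x - 1 = (f' y - 1) * g' x + (g' x - 1),
    so both defects are bounded by a constant times the defects of f, taken at
    g x, and of g ([DR_comp]). For an inverse g of f, with x = g y,
      g y - y = - (f x - x)   and   g' y - 1 = - (f' x - 1) / f' x,
    and g' = 1 / (f' o g) >= 1 / b > 0, so that the same estimate can be applied
    to composition with g ([DR_inverse]). The limits of the derivatives at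
    infinity pass through the chain rule because f and g send each end of the
    line to itself. *)

Set Implicit Arguments.
Unset Strict Implicit.
Unset Printing Implicit Defensive.

Import Order.TTheory GRing.Theory Num.Theory.
Import numFieldNormedType.Exports.

Local Open Scope ring_scope.
Local Open Scope classical_set_scope.

Local Notation "f ^` ()" := (derive1 f) : ring_scope.

(** * Groups of elements of a set *)

Lemma is_group_underI (T : Type) (A : set T) (op : T -> T -> T) (e : T)
    (inv : T -> T) :
  (forall x y, A x -> A y -> A (op x y)) -> A e ->
  (forall x, A x -> A (inv x)) ->
  associative op -> left_id e op -> right_id e op ->
  (forall x, A x -> op (inv x) x = e) -> (forall x, A x -> op x (inv x) = e) ->
  is_group_under A op.
Proof.
move=> opA eA invA opassoc op1l op1r opVl opVr.
have inA (x : A) : A (\val x) by apply: set_mem; exact: (valP x).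
pose mul (x y : A) : A := SigSub (mem_set (opA _ _ (inA x) (inA y))).
pose one : A := SigSub (mem_set eA).
pose opp (x : A) : A := SigSub (mem_set (invA _ (inA x))).
have mulA : associative mul by move=> x y z; apply: val_inj; exact: opassoc.
have mul1 : left_id one mul by move=> x; apply: val_inj; exact: op1l.
have mul1r : right_id one mul by move=> x; apply: val_inj; exact: op1r.
have mulV : left_inverse one opp mul.
  by move=> x; apply: val_inj; exact: opVl.
have mulVr : right_inverse one opp mul.
  by move=> x; apply: val_inj; exact: opVr.
pose C : choiceType :=
  HB.pack (set_type A)
    (gen_eqMixin (set_type A)) (gen_choiceMixin (set_type A)).
pose G : groupType :=
  HB.pack (set_type A) C (monoid.isGroup.Build C mulA mul1 mul1r mulV mulVr).
by exists (monoid.Group.class G).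
Qed.

(** * Square integrability *)

Section square_integrable.
Variable R : realType.
Local Notation mu := (@lebesgue_measure R).

Definition square_integrable (f : R -> R) : Prop :=
  (\int[mu]_x (`|f x| ^+ 2)%:E < +oo)%E.

Lemma continuous_sqr_norm (f : R -> R) :
  continuous f -> continuous (fun x => `|f x| ^+ 2).
Proof.
move=> cf x.
apply: (@continuous_comp _ _ _ (fun x => `|f x|) (fun y => y ^+ 2)).
  exact: (@continuous_comp _ _ _ f (fun y : R => `|y|) x (cf x)
    (@norm_continuous _ _ _)).
exact: exprn_continuous.
Qed.

Lemma measurable_EFin_continuous (f : R -> R) :
  continuous f -> measurable_fun [set: R] (fun x => (f x)%:E).
Proof.
by move=> cf; apply/measurable_EFinP; exact: continuous_measurable_fun.
Qed.

Lemma square_integrable0 (f : R -> R) :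
  (forall x, f x = 0) -> square_integrable f.
Proof.
move=> f0; rewrite /square_integrable integral0_eq ?ltry// => x _.
by rewrite f0 normr0 expr0n.
Qed.

(** Since [(p + q) ^+ 2 <= 2 * (p ^+ 2 + q ^+ 2)], the square of [f] is at most
    [2 * c ^+ 2] times the sum of the squares of [u] and [v]. *)
Lemma square_integrable_dominated (f u v : R -> R) (c : R) :
  continuous f -> continuous u -> continuous v ->
  (forall x, `|f x| <= c * (`|u x| + `|v x|)) ->
  square_integrable u -> square_integrable v -> square_integrable f.
Proof.
move=> cf cu cv fuv Lu Lv.
have m2 (w : R -> R) : continuous w ->
    measurable_fun setT (fun x : R => (`|w x| ^+ 2)%:E).
  by move=> cw; exact: (measurable_EFin_continuous (continuous_sqr_norm cw)).
have muv : measurable_fun setT (fun x => (`|u x| ^+ 2)%:E + (`|v x| ^+ 2)%:E)%E.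
  by apply: emeasurable_funD; exact: m2.
have c0 : 0 <= 2 * c ^+ 2 by rewrite mulr_ge0// sqr_ge0.
apply: (@le_lt_trans _ _
  (\int[mu]_x ((2 * c ^+ 2)%:E * ((`|u x| ^+ 2)%:E + (`|v x| ^+ 2)%:E)))%E).
  apply: ge0_le_integral => //.
  - exact: (m2 f).
  - exact: measurable_funeM.
  - move=> x _; rewrite -EFinD -EFinM lee_fin.
    have := fuv x; have := normr_ge0 (f x).
    move: `|f x| `|u x| `|v x| => p q r p0 pqr.
    apply: (@le_trans _ _ ((c * (q + r)) ^+ 2)).
      by rewrite ler_sqr ?nnegrE// (le_trans p0).
    rewrite -subr_ge0.
    have -> : 2 * c ^+ 2 * (q ^+ 2 + r ^+ 2) - (c * (q + r)) ^+ 2 =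
      (c * (q - r)) ^+ 2 by ring.
    exact: sqr_ge0.
rewrite ge0_integralZl_EFin//; last first.
  by move=> x _; rewrite adde_ge0// lee_fin sqr_ge0.
rewrite ge0_integralD//; [|exact: (m2 u)|exact: (m2 v)].
by rewrite lte_mul_pinfty ?lee_fin// lte_add_pinfty.
Qed.

End square_integrable.

(** * Functions whose derivative is bounded below by a positive constant *)

Section expanding.
Variables (R : realType) (f : R -> R) (a : R).
Hypothesis df : forall x, derivable f x 1.
Hypothesis a0 : 0 < a.
Hypothesis fa : forall x, a <= f^`() x.
Local Notation mu := (@lebesgue_measure R).

Lemma derivable_continuous : continuous f.
Proof. by move=> x; exact/differentiable_continuous/derivable1_diffP/df. Qed.

(** The mean value theorem; this linear growth is what gives injectivity and
    the limits at both ends below. *)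
Lemma expanding_le x y : x <= y -> a * (y - x) <= f y - f x.
Proof.
move=> xy.
have [||c _ ->] := @MVT_segment R f f^`() x y xy.
- by move=> z _; rewrite derive1E; exact/derivableP/df.
- by apply: continuous_subspaceT; exact: derivable_continuous.
- by rewrite ler_wpM2r ?subr_ge0.
Qed.

Lemma expanding_lt x y : x < y -> f x < f y.
Proof.
move=> xy; rewrite -subr_gt0; apply: lt_le_trans (expanding_le (ltW xy)).
by rewrite mulr_gt0// subr_gt0.
Qed.

Lemma expanding_cvgy : f x @[x --> +oo] --> +oo.
Proof.
apply/cvgryPge => A; near=> x.
have x0 : 0 <= x by [].
have := expanding_le x0; rewrite subr0 lerBrDr; apply: le_trans.
by rewrite -lerBlDr mulrC -ler_pdivrMr.
Unshelve. all: by end_near. Qed.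

Lemma expanding_cvgNy : f x @[x --> -oo] --> -oo.
Proof.
apply/cvgrNyPle => A; near=> x.
have x0 : x <= 0 by [].
have := expanding_le x0; rewrite sub0r mulrN lerBrDr => h.
have : a * x <= A - f 0.
  by rewrite mulrC -ler_pdivlMr.
lra.
Unshelve. all: by end_near. Qed.

(** The limits at both ends and the intermediate value theorem give
    surjectivity. *)
Lemma expanding_bij : exists g, cancel f g /\ cancel g f.
Proof.
have inj : injective f.
  move=> x y fxy; apply/eqP; rewrite eq_le !leNgt.
  by apply/andP; split; apply/negP => /expanding_lt; rewrite fxy ltxx.
have surj y : exists x, f x = y.
  have /cvgrNyPle/(_ y)/filter_ex[l fly] := expanding_cvgNy.
  have /cvgryPge/(_ y)/filter_ex[r yfr] := expanding_cvgy.
  have lr : l <= r.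
    rewrite leNgt; apply/negP => /expanding_lt.
    by apply/negP; rewrite -leNgt (le_trans fly).
  have cf : {within `[l, r], continuous f}.
    by apply: continuous_subspaceT; exact: derivable_continuous.
  have [|x _ fx] := IVT lr cf (v := y); last by exists x.
  by rewrite ge_min fly le_max yfr orbT.
have [g fg] := choice surj.
by exists g; split => // x; apply: inj; rewrite fg.
Qed.

(** Substitution along [f], together with [a <= f^`()], gives
    [a * \int `|h (f x)| ^+ 2 <= \int `|h y| ^+ 2]. *)
Lemma expanding_square_integrable_comp (h : R -> R) :
  continuous f^`() -> cvg (f^`() x @[x --> -oo]) ->
  cvg (f^`() x @[x --> +oo]) ->
  continuous h -> square_integrable h -> square_integrable (h \o f).
Proof.
move=> cf' cNy cy ch Lh.
have cf := derivable_continuous.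
have chf : continuous (h \o f).
  by move=> x; exact: (continuous_comp (cf x) (ch (f x))).
rewrite /square_integrable.
(* a > 0, so an infinite integral would make the product infinite. *)
suff : (a%:E * \int[mu]_x (`|(h \o f) x| ^+ 2)%:E < +oo)%E.
  by rewrite !ltey; apply: contra => /eqP ->; rewrite gt0_muley.
rewrite -ge0_integralZl_EFin ?ltW//; last first.
  exact: (measurable_EFin_continuous (continuous_sqr_norm chf)).
apply: le_lt_trans Lh.
rewrite (increasing_ge0_integration_by_substitutionT (F := f)
  (G := fun x => `|h x| ^+ 2))//; last 4 first.
- exact: expanding_lt.
- exact: expanding_cvgNy.
- exact: expanding_cvgy.
- exact: continuous_sqr_norm.
apply: ge0_le_integral => //.
- by move=> x _; rewrite -EFinM lee_fin mulr_ge0 ?sqr_ge0 ?ltW.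
- apply: measurable_funeM.
  exact: (measurable_EFin_continuous (continuous_sqr_norm chf)).
- apply: measurable_EFin_continuous => x.
  by apply: cvgM; [exact: (@continuous_sqr_norm _ (h \o f))|exact: cf'].
- by move=> x _; rewrite -EFinM lee_fin mulrC ler_wpM2l ?sqr_ge0.
Qed.

End expanding.

(** * Derivative of an inverse bijection *)

Section derivative_inverse.
Variables (R : realType) (f g : R -> R).
Hypothesis df : forall x, derivable f x 1.
Hypothesis f'0 : forall x, f^`() x != 0.
Hypothesis fK : cancel f g.
Hypothesis gK : cancel g f.

Lemma is_derive1_inverse (y : R) : is_derive y 1 g (f^`() (g y))^-1.
Proof.
rewrite -[y in is_derive y]gK; apply: is_derive_inverse => //.
- by near=> x.
- by near=> x; exact: derivable_continuous.
- by rewrite derive1E; exact/derivableP/df.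
Unshelve. all: by end_near. Qed.

Lemma derive1_inverse : g^`() = fun y => (f^`() (g y))^-1.
Proof.
by apply/funext => y; rewrite derive1E; have [_ ->] := is_derive1_inverse y.
Qed.

End derivative_inverse.

(** * Stability of D(R) under composition and inversion *)

Section DR_group.
Variable R : realType.

Lemma DR_continuous (f : R -> R) : DR f -> continuous f.
Proof. by case=> df _ _ _ _ _; exact: derivable_continuous. Qed.

Lemma DR_continuous_sub (f : R -> R) : DR f -> continuous (fun x => f x - x).
Proof.
by move=> /DR_continuous cf x; apply: cvgB; [exact: cf|exact: cvg_id].
Qed.

Lemma DR_continuous_derive_sub (f : R -> R) :
  DR f -> continuous (fun x => f^`() x - 1).
Proof. by case=> _ cf' _ _ _ _ x; apply: cvgB; [exact: cf'|exact: cvg_cst]. Qed.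

Lemma DR_square_integrable_comp (f h : R -> R) :
  DR f -> continuous h -> square_integrable h -> square_integrable (h \o f).
Proof.
case=> df cf' [a [b [a0 _ fab]]] _ _ [cy cNy].
apply: (expanding_square_integrable_comp (a := a)) => //.
- by move=> x; have /andP[] := fab x.
- by apply/cvg_ex; exists 1.
- by apply/cvg_ex; exists 1.
Qed.

Lemma DR_cvg_infty (f : R -> R) : DR f ->
  f x @[x --> +oo] --> +oo /\ f x @[x --> -oo] --> -oo.
Proof.
case=> df _ [a [b [a0 _ fab]]] _ _ _.
have fa x : a <= f^`() x by have /andP[] := fab x.
by split; [exact: expanding_cvgy df a0 fa|exact: expanding_cvgNy df a0 fa].
Qed.

Lemma DR_id : DR (@id R).
Proof.
have did : (@id R)^`() = cst 1 by apply/funext => x; rewrite derive1_id.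
split => //.
- by rewrite did; exact: cst_continuous.
- by exists (1 / 2), 2; rewrite did; split => [||x /=]; lra.
- by apply: square_integrable0 => x; rewrite subrr.
- by apply: square_integrable0 => x; rewrite did subrr.
- by rewrite did; split; exact: cvg_cst.
Qed.

Lemma DR_comp (f g : R -> R) : DR f -> DR g -> DR (f \o g).
Proof.
move=> Df Dg.
have [df cf' [a [b [a0 ab fab]]] Lf Lf' [f'y f'Ny]] := Df.
have [dg cg' [c [d [c0 cd gcd]]] Lg Lg' [g'y g'Ny]] := Dg.
have [gy gNy] := DR_cvg_infty Dg.
have cg := DR_continuous Dg.
have dfg : (f \o g)^`() = fun x => f^`() (g x) * g^`() x.
  by apply/funext => x; rewrite derive1_comp.
have cfg x : {for x, continuous (f \o g)}.
  exact: (continuous_comp (cg x) (DR_continuous Df (x := g x))).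
have cfg' : continuous (f \o g)^`().
  rewrite dfg => x; apply: cvgM; last exact: cg'.
  exact: (continuous_comp (cg x) (cf' (g x))).
split.
- by move=> x; apply: ex_derive; apply: is_derive1_comp; exact/derivableP.
- exact: cfg'.
- exists (a * c), (b * d); split; [exact: mulr_gt0|by rewrite ltr_pM// ltW|].
  move=> x; rewrite dfg; have /andP[? ?] := fab (g x); have /andP[? ?] := gcd x.
  by rewrite !ler_pM// ?ltW//; [exact: lt_le_trans a0 _|exact: lt_le_trans c0 _].
- apply: (square_integrable_dominated (u := (fun x => f x - x) \o g)
      (v := fun x => g x - x) (c := 1)) => //.
  + by move=> x; apply: cvgB; [exact: cfg|exact: cvg_id].
  + move=> x; exact: (continuous_comp (cg x) (DR_continuous_sub Df (x := g x))).
  + exact: DR_continuous_sub.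
  + move=> x /=; rewrite mul1r; apply: le_trans (ler_normD _ _).
    by rewrite addrA subrK.
  + exact: (DR_square_integrable_comp Dg (DR_continuous_sub Df) Lf).
  (* [d] bounds the factor [g^`() x] of the first defect, [1] is the
     coefficient of the second one; [d + 1] bounds both. *)
- apply: (square_integrable_dominated (f := fun x => (f \o g)^`() x - 1)
      (u := (fun x => f^`() x - 1) \o g) (v := fun x => g^`() x - 1)
      (c := d + 1)).
  + by move=> x; apply: cvgB; [exact: cfg'|exact: cvg_cst].
  + move=> x.
    exact: (continuous_comp (cg x) (DR_continuous_derive_sub Df (x := g x))).
  + exact: DR_continuous_derive_sub.
  + move=> x /=; rewrite dfg.
    have -> : f^`() (g x) * g^`() x - 1 =
      (f^`() (g x) - 1) * g^`() x + (g^`() x - 1) by ring.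
    apply: le_trans (ler_normD _ _) _; rewrite normrM.
    have /andP[cx xd] := gcd x.
    rewrite (ger0_norm (le_trans (ltW c0) cx)).
    have := normr_ge0 (f^`() (g x) - 1); have := normr_ge0 (g^`() x - 1).
    by move: `|_| `|_| => p q; nra.
  + exact: (DR_square_integrable_comp Dg (DR_continuous_derive_sub Df) Lf').
  + exact: Lg'.
- rewrite dfg -[X in _ --> X /\ _]mulr1 -[X in _ /\ _ --> X]mulr1.
  split; apply: cvgM.
  + exact: (cvg_comp _ _ gy f'y).
  + exact: g'y.
  + exact: (cvg_comp _ _ gNy f'Ny).
  + exact: g'Ny.
Qed.

Lemma DR_inverse (f g : R -> R) : DR f -> cancel f g -> cancel g f -> DR g.
Proof.
move=> Df fK gK.
have [df cf' [a [b [a0 ab fab]]] Lf Lf' [f'y f'Ny]] := Df.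
have f'0 x : 0 < f^`() x.
  by have /andP[+ _] := fab x; exact: lt_le_trans.
have f'N0 x : f^`() x != 0 by rewrite gt_eqF.
have b0 : 0 < b := lt_trans a0 ab.
have dg x : derivable g x 1.
  by apply: ex_derive; exact: is_derive1_inverse df f'N0 fK gK x.
have cg := derivable_continuous dg.
have g'E := derive1_inverse df f'N0 fK gK.
have cg' : continuous g^`().
  rewrite g'E => x; apply: cvgV => //.
  exact: (continuous_comp (cg x) (cf' (g x))).
have gab x : b^-1 <= g^`() x <= a^-1.
  by rewrite g'E !lef_pV2 ?posrE// andbC.
have bV0 : 0 < b^-1 by rewrite invr_gt0.
have gb x : b^-1 <= g^`() x by have /andP[] := gab x.
have gy := expanding_cvgy dg bV0 gb.
have gNy := expanding_cvgNy dg bV0 gb.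
have g'y : g^`() x @[x --> +oo] --> (1 : R).
  rewrite g'E -[X in _ --> X]invr1; apply: cvgV; first exact: oner_neq0.
  exact: (cvg_comp _ _ gy f'y).
have g'Ny : g^`() x @[x --> -oo] --> (1 : R).
  rewrite g'E -[X in _ --> X]invr1; apply: cvgV; first exact: oner_neq0.
  exact: (cvg_comp _ _ gNy f'Ny).
have Lcomp (h : R -> R) :
    continuous h -> square_integrable h -> square_integrable (h \o g).
  apply: (expanding_square_integrable_comp dg bV0 gb) => //.
  - by apply/cvg_ex; exists 1.
  - by apply/cvg_ex; exists 1.
split.
- exact: dg.
- exact: cg'.
- exists b^-1, a^-1; split => //.
  by rewrite ltf_pV2.
  (* At [x = g y], [f x - x] is [y - g y]. *)
- have := Lcomp _ (DR_continuous_sub Df) Lf.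
  rewrite /square_integrable; congr (_ < _)%E; apply: eq_integral => y _ /=.
  by rewrite gK distrC.
- apply: (square_integrable_dominated (f := fun x => g^`() x - 1)
      (u := (fun x => f^`() x - 1) \o g) (v := cst 0) (c := a^-1)).
  + by move=> x; apply: cvgB; [exact: cg'|exact: cvg_cst].
  + move=> x.
    exact: (continuous_comp (cg x) (DR_continuous_derive_sub Df (x := g x))).
  + exact: cst_continuous.
  + move=> x /=; rewrite normr0 addr0 g'E.
    have -> : (f^`() (g x))^-1 - 1 = (f^`() (g x))^-1 * (1 - f^`() (g x)).
      by rewrite mulrBr mulr1 mulVf.
    rewrite normrM distrC ler_wpM2r// gtr0_norm ?invr_gt0//.
    by rewrite lef_pV2 ?posrE//; have /andP[] := fab (g x).
  + exact: (Lcomp _ (DR_continuous_derive_sub Df) Lf').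
  + exact: square_integrable0.
- by [].
Qed.

Lemma DR_bij (f : R -> R) : DR f -> exists g, cancel f g /\ cancel g f.
Proof.
case=> df _ [a [b [a0 _ fab]]] _ _ _.
by apply: (expanding_bij df a0) => x; have /andP[] := fab x.
Qed.

End DR_group.

Theorem proposition4 (R : realType) :
  is_group_under (@DR R) (fun f g : R -> R => f \o g).
Proof.
(* [inv] must be total on [R -> R]; its values outside D(R) are arbitrary. *)
have /choice[inv invP] (f : R -> R) :
    exists g, DR f -> cancel f g /\ cancel g f.
  have [/DR_bij[g gP]|nDf] := pselect (DR f); first by exists g.
  by exists id.
apply: (is_group_underI (e := id) (inv := inv)) => //.
- exact: DR_comp.
- exact: DR_id.
- by move=> f Df; have [fK gK] := invP f Df; exact: DR_inverse fK gK.
- by move=> f Df; have [fK _] := invP f Df; exact/funext.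
- by move=> f Df; have [_ gK] := invP f Df; exact/funext.
Qed.
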